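(* Assume that (1) the chain with kernel $p$ has a unique stationary distribution $\mu$ and $\mu(U)>0$ for every non-empty (relatively) open $U\subseteq\mathcal S$; (2) $\sup_{s\in\mathcal S}\|x(s)\|<\infty$ and $\sup_{s\in\mathcal S}|r(s)|<\infty$; (3) for every measurable $f:\mathcal S\to\mathbb R^n$ with $f=0$ $\mu$-a.e., also $P_\pi f=0$ $\mu$-a.e. Then $\mathcal W_*=\{w\in\mathbb R^d: Aw+b=0\}$ is non-empty.
   Context: Setting: $K,d\in\mathbb N$; $\mathcal S\subseteq\mathbb R^K$ with its Borel $\sigma$-algebra; $p(\cdot\mid s)$ is a Markov transition kernel on $\mathcal S$; $r:\mathcal S\to\mathbb R$ is measurable; $\gamma\in[0,1)$; $x:\mathcal S\to\mathbb R^d$ is a measurable feature map (no linear independence is assumed). $(P_\pi f)(s)=\int_{\mathcal S}f(s')\,p(ds'\mid s)$. A stationary distribution is a probability measure $\mu$ with $\mu(Z)=\int_{\mathcal S}p(Z\mid s)\mu(ds)$ for all Borel $Z\subseteq\mathcal S$. $A=\int_{\mathcal S}x(s)\left(\gamma(P_\pi x)(s)^\top-x(s)^\top\right)\mu(ds)\in\mathbb R^{d\times d}$ and $b=\int_{\mathcal S}x(s)r(s)\mu(ds)\in\mathbb R^d$. *)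

(* Defs.v *)
From HB Require Import structures.
From mathcomp Require Import all_boot all_order all_algebra.
From mathcomp Require Import all_classical all_reals all_analysis.
Set Implicit Arguments.
Unset Strict Implicit.
Unset Printing Implicit Defensive.
Import Order.TTheory GRing.Theory Num.Theory.
Import numFieldNormedType.Exports.
Local Open Scope classical_set_scope.
Local Open Scope ring_scope.

(* A non-empty subset S of a topological space, as a type of its own with the
   relative topology.  The measurable types of the library must be pointed,
   hence the proof of non-emptiness; a set that carries a probability measure
   is non-empty anyway. *)
Definition subspace_of (T : topologicalType) (S : set T) (S0 : S !=set0) : Type
  := set_type S.

Section subspace_of_instances.
Variables (T : topologicalType) (S : set T) (S0 : S !=set0).

HB.instance Definition _ := Topological.copy (subspace_of S0) (set_type S).

HB.instance Definition _ := isPointed.Build (subspace_of S0)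
  (exist _ (sval (cid S0)) (mem_set (svalP (cid S0)))).

End subspace_of_instances.

Notation borel T := (g_sigma_algebraType (@open T)).

Definition euclidean_norm (R : realType) (n : nat) (v : 'cV[R]_n) : R :=
  Num.sqrt (\sum_(i < n) v i 0 ^+ 2).

(* The integral of a matrix-valued function is taken entrywise.  An entry whose
   integral is infinite or undefined gets a default value. *)
Definition mx_integral (R : realType) (d : measure_display)
    (T : measurableType d) (mu : {measure set T -> \bar R}) (m n : nat)
    (F : T -> 'M[R]_(m, n)) : 'M[R]_(m, n) :=
  \matrix_(i, j) \int[mu]_s F s i j.

Section markov_chain.
Variables (R : realType) (d : measure_display) (T : measurableType d).
Variable p : R.-pker T ~> T.

Definition transition_op (n : nat) (f : T -> 'cV[R]_n) (s : T) : 'cV[R]_n :=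
  mx_integral (p s) f.

Definition stationary (mu : probability T R) : Prop :=
  forall Z : set T, measurable Z -> mu Z = (\int[mu]_s p s Z)%E.

(* Measures in the library are functions on all sets, with unspecified values
   on the non-measurable ones, so uniqueness is stated on measurable sets. *)
Definition unique_stationary (mu : probability T R) : Prop :=
  stationary mu /\
  forall nu : probability T R, stationary nu ->
    forall Z : set T, measurable Z -> nu Z = mu Z.

Definition td_matrix (gamma : R) (k : nat) (x : T -> 'cV[R]_k)
    (mu : probability T R) : 'M[R]_k :=
  mx_integral mu
    (fun s => x s *m (gamma *: (transition_op x s)^T - (x s)^T)).

Definition td_vector (r : T -> R) (k : nat) (x : T -> 'cV[R]_k)
    (mu : probability T R) : 'cV[R]_k :=
  mx_integral mu (fun s => r s *: x s).

End markov_chain.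

(* Main.v *)
(* The equation A w = -b is solvable as soon as u^T b = 0 for every u with
   u^T A = 0.  Given such a u, put f = u^T x; then 0 = u^T A u =
   gamma E[f Pf] - E[f^2], where E is the integral against mu.  Stationarity and
   0 <= E[(f(s) - f(s'))^2] for s distributed as mu and s' as p(. | s) give
   E[f Pf] <= E[f^2], so E[f^2] = 0 because gamma < 1; hence f = 0 almost
   everywhere and u^T b = E[r f] = 0. *)
Require Import Defs.
From HB Require Import structures.
From mathcomp Require Import all_boot all_order all_algebra.
From mathcomp Require Import all_classical all_reals all_analysis.
From mathcomp Require Import measurable_realfun giry ring lra.
Import Order.TTheory GRing.Theory Num.Theory.
Import numFieldNormedType.Exports.
Local Open Scope classical_set_scope.
Local Open Scope ring_scope.

(** * Bounded measurable functions and their real integrals *)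

Section bounded_measurable.
Context {d : measure_display} {T : measurableType d} {R : realType}.
Implicit Types (f g : T -> R) (mu : probability T R).

(** This class is closed under sums, products and the transition operator, and its members are
    integrable against every probability measure, so all integrability side conditions reduce to
    membership. *)
Definition bounded_measurable f :=
  measurable_fun setT f /\ exists M, forall s, `|f s| <= M.

Lemma bounded_measurable_cst (a : R) : bounded_measurable (fun=> a).
Proof. by split; [exact: measurable_cst|exists `|a|]. Qed.

Lemma bounded_measurableD {f g} :
  bounded_measurable f -> bounded_measurable g ->
  bounded_measurable (fun s => f s + g s).
Proof.
move=> [mf [M fM]] [mg [N gN]]; split; first exact: measurable_funD.
by exists (M + N) => s; rewrite (le_trans (ler_normD _ _))// lerD.
Qed.

Lemma bounded_measurableM {f g} :
  bounded_measurable f -> bounded_measurable g ->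
  bounded_measurable (fun s => f s * g s).
Proof.
move=> [mf [M fM]] [mg [N gN]]; split; first exact: measurable_funM.
by exists (M * N) => s; rewrite normrM ler_pM.
Qed.

Lemma bounded_measurableB {f g} :
  bounded_measurable f -> bounded_measurable g ->
  bounded_measurable (fun s => f s - g s).
Proof.
move=> [mf [M fM]] [mg [N gN]]; split; first exact: measurable_funB.
by exists (M + N) => s; rewrite (le_trans (ler_normB _ _))// lerD.
Qed.

Lemma bounded_measurable_sum {n} {f : 'I_n -> T -> R} :
  (forall i, bounded_measurable (f i)) ->
  bounded_measurable (fun s => \sum_i f i s).
Proof.
move=> fbm; split; first by apply: measurable_sum => i; exact: (fbm i).1.
have /choice[M fM] := fun i => (fbm i).2.
exists (\sum_i M i) => s; rewrite (le_trans (ler_norm_sum _ _ _))//.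
by apply: ler_sum => i _; exact: fM.
Qed.

Lemma bounded_measurable_integrable {mu f} :
  bounded_measurable f -> mu.-integrable setT (EFin \o f).
Proof.
move=> [mf [M fM]]; apply: measurable_bounded_integrable => //.
  by rewrite (le_lt_trans (probability_le1 _ _))// ltry.
exists M; split; first exact: num_real.
by move=> N /ltW MN s _; exact: le_trans (fM s) MN.
Qed.

Lemma Rintegral_sum_bounded {mu n} {f : 'I_n -> T -> R} :
  (forall i, bounded_measurable (f i)) ->
  \int[mu]_s (\sum_i f i s) = \sum_i \int[mu]_s f i s.
Proof.
elim: n f => [|n IHn] f fbm.
  under eq_Rintegral do rewrite big_ord0.
  by rewrite big_ord0 Rintegral_cst// mul0r.
under eq_Rintegral do rewrite big_ord_recl.
rewrite RintegralD ?IHn ?big_ord_recl//;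
  apply: bounded_measurable_integrable => //.
exact: bounded_measurable_sum.
Qed.

(** The nonnegative function f^2 has integral zero, so f vanishes almost everywhere, and the product
    g f with it. *)
Lemma Rintegral_sqr_eq0 {mu f g} :
  bounded_measurable f -> measurable_fun setT g ->
  \int[mu]_s (f s * f s) <= 0 -> \int[mu]_s (g s * f s) = 0.
Proof.
move=> fbm mg f0.
have ff0 : (\int[mu]_s `|(f s * f s)%:E| = 0)%E.
  transitivity (\int[mu]_s (f s * f s)%:E)%E.
    by apply: eq_integral => s _; rewrite gee0_abs// lee_fin -expr2 sqr_ge0.
  have ffi := @bounded_measurable_integrable mu _ (bounded_measurableM fbm fbm).
  (* The real integral is [fine] of the extended one, and [fine] sends infinities to 0;
     integrability of f^2 rules that case out. *)
  rewrite -[LHS]fineK ?integrable_fin_num//; congr EFin.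
  apply/eqP; rewrite eq_le f0/= fine_ge0// integral_ge0// => s _.
  by rewrite lee_fin -expr2 sqr_ge0.
rewrite /Rintegral (ae_eq_integral (cst 0%E))//.
- by rewrite integral0.
- by apply/measurable_EFinP/measurable_funM => //; exact: fbm.1.
have [+ _] := ae_eq_integral_abs mu measurableT
  (proj2 (measurable_EFinP _ _) (bounded_measurableM fbm fbm).1).
move=> /(_ ff0); apply: filterS => s /= /(_ Logic.I) [/eqP].
by rewrite mulf_eq0 orbb => /eqP -> _; rewrite mulr0.
Qed.

End bounded_measurable.

(** * Integration against the kernel and a stationary measure *)

Section probability_kernel.
Context {d : measure_display} {T : measurableType d} {R : realType}.
Variable p : R.-pker T ~> T.
Implicit Types (f g : T -> R) (mu : probability T R).

(* The library sees [p s] as a measure only; this constant carries the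
   probability structure. *)
Definition transition_probability (s : T) : set T -> \bar R := p s.

HB.instance Definition _ s := Measure.copy (transition_probability s) (p s).

HB.instance Definition _ s :=
  Measure_isProbability.Build d T R (transition_probability s) (prob_kernel s).

Lemma transition_integrable {f s} :
  bounded_measurable f -> (p s).-integrable setT (EFin \o f).
Proof.
exact: (@bounded_measurable_integrable _ _ _ (transition_probability s)).
Qed.

(** The kernel is a measurable map into the Giry space, so the iterated integral is an integral
    against the bind of [mu] along it; stationarity says that this bind agrees with [mu] on
    measurable sets. *)
Lemma integral_stationary {mu} {h : T -> \bar R} :
  stationary p mu -> measurable_fun setT h -> (forall s, 0 <= h s)%E ->
  (\int[mu]_s \int[p s]_t h t = \int[mu]_s h s)%E.
Proof.
move=> pmu mh h0.
pose k (s : T) : giry T R := transition_probability s.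
have mk : measurable_fun setT k.
  by apply: measurable_giry_codensity => // B mB; exact: (measurable_kernel p).
have := giry_int_bind mu mk mh h0; rewrite /giry_int => <-.
apply: eq_measure_integral => A mA _.
apply: etrans (esym (pmu A mA)).
by apply: giry_int_map => //; exact: measurable_giry_ev.
Qed.

(** The mass of [p s] is one, so constants pass through. When M bounds |f|, the function f + M is
    nonnegative, which brings f within reach of results on nonnegative functions. *)
Lemma transition_shift {f s} (M : R) : bounded_measurable f ->
  \int[p s]_t f t = \int[p s]_t (f t + M) - M.
Proof.
move=> fbm; rewrite RintegralD ?Rintegral_cst//.
- by rewrite prob_kernel mulr1 addrK.
- exact: transition_integrable.
- exact/transition_integrable/bounded_measurable_cst.
Qed.

Lemma bounded_measurable_transition {f} : bounded_measurable f ->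
  bounded_measurable (fun s => \int[p s]_t f t).
Proof.
move=> fbm; have [mf [M fM]] := fbm; split; last first.
  exists M => s.
  have fi := @transition_integrable _ s fbm.
  rewrite (le_trans (le_normr_Rintegral measurableT fi))//.
  rewrite [leRHS](_ : _ = \int[p s]_t M); last first.
    by rewrite Rintegral_cst// prob_kernel mulr1.
  apply: le_Rintegral => //.
  - exact/integrable_norm/transition_integrable.
  - exact/transition_integrable/bounded_measurable_cst.
rewrite (_ : (fun _ => _) = fun s => \int[p s]_t (f t + M) - M); last first.
  by apply/funext => s; exact: transition_shift.
apply: measurable_funB => //; apply: measurableT_comp => //.
apply: measurable_fun_integral_kernel => //.
- by move=> U mU; exact: measurable_kernel.
- move=> t; rewrite lee_fin -lerBlDr sub0r.
  by have := fM t; rewrite ler_norml => /andP[].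
- exact/measurable_EFinP/measurable_funD.
Qed.

Lemma Rintegral_stationary {mu f} : stationary p mu -> bounded_measurable f ->
  \int[mu]_s \int[p s]_t f t = \int[mu]_s f s.
Proof.
move=> pmu fbm; have [mf [M fM]] := fbm.
have cbm : @bounded_measurable _ T _ (fun=> M) by exact: bounded_measurable_cst.
have gbm := bounded_measurableD fbm cbm.
under eq_Rintegral do rewrite (transition_shift M fbm).
rewrite RintegralB//; last 2 first.
- exact/bounded_measurable_integrable/bounded_measurable_transition.
- exact: bounded_measurable_integrable.
rewrite [X in X - _](_ : _ = \int[mu]_s (f s + M)).
  rewrite RintegralD//; last 2 first.
  - exact: bounded_measurable_integrable.
  - exact: bounded_measurable_integrable.
  by rewrite addrK.
(* f + M is nonnegative, so the extended-real form of stationarity applies to it. *)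
rewrite /Rintegral -[in RHS](integral_stationary pmu)//.
- congr fine; apply: eq_integral => s _.
  by rewrite fineK// integrable_fin_num//; exact: transition_integrable.
- by apply/measurable_EFinP; exact: gbm.1.
- move=> t; rewrite lee_fin -lerBlDr sub0r.
  by have := fM t; rewrite ler_norml => /andP[].
Qed.

Lemma Rintegral_mul_transition_le {mu f} :
  stationary p mu -> bounded_measurable f ->
  \int[mu]_s (f s * \int[p s]_t f t) <= \int[mu]_s (f s * f s).
Proof.
move=> pmu fbm.
have ffbm := bounded_measurableM fbm fbm.
have Pfbm := bounded_measurable_transition fbm.
have fPfbm := bounded_measurableM fbm Pfbm.
(* This is the expansion of the square (f s - f t)^2, integrated in t against [p s]. Integrating in
   s then turns the last term into E[f^2] by stationarity. *)
have pointwise s : f s * \int[p s]_t f t + f s * \int[p s]_t f t <=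
    f s * f s + \int[p s]_t (f t * f t).
  have : 0 <= \int[p s]_t ((f s - f t) * (f s - f t)).
    by apply: Rintegral_ge0 => t _; rewrite -expr2 sqr_ge0.
  rewrite [leRHS](_ : _ =
      \int[p s]_t (f t * f t - (f s + f s) * f t + f s * f s)); last first.
    by apply: eq_Rintegral => t _; ring.
  have cbm (a : R) : @bounded_measurable _ T _ (fun=> a).
    exact: bounded_measurable_cst.
  have fsbm := bounded_measurableM (cbm (f s + f s)) fbm.
  rewrite RintegralD ?RintegralB ?RintegralZl ?Rintegral_cst//;
    try exact: transition_integrable.
    by rewrite prob_kernel/=; lra.
  exact/transition_integrable/bounded_measurableB.
have := @le_Rintegral _ _ _ mu setT _ _ measurableT
  (bounded_measurable_integrable (bounded_measurableD fPfbm fPfbm))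
  (bounded_measurable_integrable
    (bounded_measurableD ffbm (bounded_measurable_transition ffbm)))
  (fun s _ => pointwise s).
rewrite !RintegralD//; try exact: bounded_measurable_integrable; last first.
  exact/bounded_measurable_integrable/bounded_measurable_transition.
rewrite (Rintegral_stationary pmu ffbm); lra.
Qed.

Lemma Rintegral_td_kernel {mu} {gamma : R} {f r : T -> R} : stationary p mu ->
  0 <= gamma < 1 -> bounded_measurable f -> measurable_fun setT r ->
  \int[mu]_s (f s * (gamma * \int[p s]_t f t - f s)) = 0 ->
  \int[mu]_s (r s * f s) = 0.
Proof.
move=> pmu /andP[gamma0 gamma1] fbm mr.
have fPfbm := bounded_measurableM fbm (bounded_measurable_transition fbm).
have ffbm := bounded_measurableM fbm fbm.
under eq_Rintegral do rewrite mulrBr mulrCA.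
rewrite RintegralB ?RintegralZl//; try exact: bounded_measurable_integrable;
  last first.
  apply: bounded_measurable_integrable.
  exact: bounded_measurableM (bounded_measurable_cst gamma) fPfbm.
move=> /eqP; rewrite subr_eq0 => /eqP E.
apply: (Rintegral_sqr_eq0 (mu := mu) fbm mr).
(* With a = E[f Pf] and q = E[f^2], the relations gamma a = q and a <= q give q <= gamma q, hence q
   <= 0. *)
have := Rintegral_mul_transition_le pmu fbm.
by nra.
Qed.

End probability_kernel.

(** * From vector-valued hypotheses to real coordinates *)

Section borel.
Context {R : realType}.

Lemma measurable_coord {d : nat} (i : 'I_d) :
  measurable_fun setT (fun v : borel 'cV[R]_d => v i 0).
Proof.
have /continuousP coord_open := @coord_continuous R d 1 i 0.
(* Open intervals generate the Borel sets of the line, and their preimages under the continuous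
   coordinate are open. *)
apply: (measurability _ (RGenOpens.measurableE R)) => _ [_ [a [b ->] <-]].
by rewrite setTI; apply: sub_sigma_algebra; exact/coord_open/interval_open.
Qed.

Lemma ler_norm_coord_euclidean {n : nat} (v : 'cV[R]_n) i :
  `|v i 0| <= euclidean_norm v.
Proof.
rewrite -sqrtr_sqr /euclidean_norm ler_wsqrtr// (bigD1 i)//= lerDl.
by apply: sumr_ge0 => j _; exact: sqr_ge0.
Qed.

Lemma bounded_of_ereal_sup {T : Type} {f : T -> R} :
  (forall s, 0 <= f s) -> (ereal_sup [set (f s)%:E | s in setT] < +oo)%E ->
  exists M, forall s, f s <= M.
Proof.
move=> f0 fsup; exists (fine (ereal_sup [set (f s)%:E | s in setT])) => s.
have ubs : ((f s)%:E <= ereal_sup [set (f s)%:E | s in setT])%E.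
  by apply: ereal_sup_ubound; exists s.
(* The point s at hand gives 0 <= f s <= sup, so the supremum is finite and [fine] returns its true
   value. *)
rewrite -lee_fin fineK// ge0_fin_numE// (le_trans _ ubs)// lee_fin.
exact: f0.
Qed.

End borel.

(** The finite-dimensional Fredholm alternative. The rows of N below lie in the left kernel of A,
    and N b = 0 is, after transposition, the cokernel test for -b^T to lie in the row space of
    A^T. *)
Lemma solvable_of_left_kernel {F : fieldType} {n : nat} (A : 'M[F]_n)
    (b : 'cV[F]_n) :
  (forall u : 'cV[F]_n, u^T *m A = 0 -> u^T *m b = 0) ->
  exists w, A *m w + b = 0.
Proof.
move=> kerAb.
pose N := (cokermx A^T)^T.
have NA0 : N *m A = 0.
  by apply: trmx_inj; rewrite trmx_mul trmxK mulmx_coker trmx0.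
have Nb0 : N *m b = 0.
  apply/row_matrixP => i; rewrite row_mul -[row i N]trmxK kerAb ?row0//.
  by rewrite trmxK -row_mul NA0 row0.
have /submxP[w wE] : (- b^T <= A^T)%MS.
  by rewrite submxE mulNmx oppr_eq0 -trmx_eq0 trmx_mul trmxK Nb0.
exists w^T; apply: trmx_inj.
by rewrite linearD/= trmx_mul trmxK -wE addNr trmx0.
Qed.

Theorem lemma4 (R : realType) (K d : nat)
    (S : set 'cV[R]_K) (S0 : S !=set0)
    (p : R.-pker borel (subspace_of S0) ~> borel (subspace_of S0))
    (r : borel (subspace_of S0) -> R) (r_meas : measurable_fun setT r)
    (gamma : R) (gamma_ge0 : 0 <= gamma) (gamma_lt1 : gamma < 1)
    (x : borel (subspace_of S0) -> borel 'cV[R]_d)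
    (x_meas : measurable_fun setT x)
    (mu : probability (borel (subspace_of S0)) R)
    (mu_unique : unique_stationary p mu)
    (mu_open : forall U : set (subspace_of S0),
      open U -> U !=set0 -> (0 < mu U)%E)
    (x_bounded : (ereal_sup [set (euclidean_norm (x s))%:E | s in setT] < +oo)%E)
    (r_bounded : (ereal_sup [set `|r s|%:E | s in setT] < +oo)%E)
    (transition_null : forall (n : nat)
        (f : borel (subspace_of S0) -> borel 'cV[R]_n),
      measurable_fun setT f ->
      {ae mu, forall s, f s = (0 : 'cV[R]_n)} ->
      {ae mu, forall s, transition_op p f s = 0}) :
  [set w : 'cV[R]_d | td_matrix p gamma x mu *m w + td_vector r x mu = 0]
    !=set0.
Proof.
have xbm i : bounded_measurable (fun s => x s i 0).
  split; first exact: measurableT_comp (measurable_coord i) x_meas.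
  have [M xM] := bounded_of_ereal_sup (fun=> sqrtr_ge0 _) x_bounded.
  by exists M => s; apply: le_trans (xM s); exact: ler_norm_coord_euclidean.
have rbm : bounded_measurable r.
  by split=> //; exact: bounded_of_ereal_sup (fun=> normr_ge0 _) r_bounded.
have [pmu _] := mu_unique.
suff [w Aw] : exists w, td_matrix p gamma x mu *m w + td_vector r x mu = 0.
  by exists w.
apply: solvable_of_left_kernel => u uA0.
pose f s := \sum_i u i 0 * x s i 0.
have uxbm i : bounded_measurable (fun s => u i 0 * x s i 0).
  exact: bounded_measurableM (bounded_measurable_cst _) (xbm i).
have fbm : bounded_measurable f := bounded_measurable_sum uxbm.
pose Px i s := \int[p s]_t x t i 0.
have PfE s : \int[p s]_t f t = \sum_i u i 0 * Px i s.
  rewrite [LHS](Rintegral_sum_bounded (mu := transition_probability p s) uxbm).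
  by apply: eq_bigr => i _; rewrite RintegralZl//; exact: transition_integrable.
(* The (i, j) entry of the integrand that defines A. *)
pose y i j s := x s i 0 * (gamma * Px j s - x s j 0).
have ybm i j : bounded_measurable (y i j).
  apply: bounded_measurableM => //; apply: bounded_measurableB => //.
  apply: bounded_measurableM; first exact: bounded_measurable_cst.
  exact: bounded_measurable_transition.
have AE i j : td_matrix p gamma x mu i j = \int[mu]_s y i j s.
  by rewrite mxE; apply: eq_Rintegral => s _; rewrite !mxE big_ord1 !mxE.
have bE i : td_vector r x mu i 0 = \int[mu]_s (r s * x s i 0).
  by rewrite mxE; apply: eq_Rintegral => s _; rewrite !mxE.
have uyubm i j : bounded_measurable (fun s => u i 0 * y i j s * u j 0).
  apply: bounded_measurableM; last exact: bounded_measurable_cst.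
  by apply: bounded_measurableM => //; exact: bounded_measurable_cst.
(* By linearity this integral is the quadratic form u^T A u, which vanishes because u^T A = 0. *)
have fker : \int[mu]_s (f s * (gamma * \int[p s]_t f t - f s)) = 0.
  transitivity ((u^T *m td_matrix p gamma x mu *m u) 0 0); last first.
    by rewrite uA0 mul0mx mxE.
  (* Summing over j outside and i inside matches the expansion of (u^T A) u. *)
  transitivity (\int[mu]_s \sum_j \sum_i (u i 0 * y i j s * u j 0)).
    apply: eq_Rintegral => s _; rewrite exchange_big/= PfE {1}/f mulr_suml.
    apply: eq_bigr => i _; rewrite mulr_sumr -sumrB mulr_sumr.
    by apply: eq_bigr => j _; rewrite /y; ring.
  rewrite Rintegral_sum_bounded; last first.
    by move=> j; exact: bounded_measurable_sum.
  rewrite mxE; apply: eq_bigr => j _.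
  rewrite Rintegral_sum_bounded// mxE mulr_suml; apply: eq_bigr => i _.
  rewrite mxE AE RintegralZr ?RintegralZl//;
    apply: bounded_measurable_integrable => //.
  by apply: bounded_measurableM => //; exact: bounded_measurable_cst.
have gammaP : 0 <= gamma < 1 by rewrite gamma_ge0.
have := Rintegral_td_kernel p pmu gammaP fbm r_meas fker.
have rxbm i : bounded_measurable (fun s => r s * x s i 0).
  exact: bounded_measurableM.
(* The only entry of u^T b is E[r f], by linearity again. *)
move=> rf0; apply/matrixP => i k; rewrite !ord1 [RHS]mxE -[RHS]rf0 mxE.
under [RHS]eq_Rintegral do rewrite mulr_sumr.
under [RHS]eq_Rintegral do under eq_bigr do rewrite mulrCA.
rewrite Rintegral_sum_bounded; last first.
  by move=> j; apply: bounded_measurableM => //; exact: bounded_measurable_cst.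
apply: eq_bigr => j _; rewrite mxE bE RintegralZl//.
exact: bounded_measurable_integrable.
Qed.
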